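(* Consider the two-player treatment model described in the context, and suppose that: (a) (strategic complementarity) $P_j^1-P_j^0>0$ almost surely for $j=1,2$; (b) $P_j^0,P_j^1$ ($j=1,2$) are identified, and the conditional CDF $H(v_1,v_2\mid x)$ and density $h(v_1,v_2\mid x)$ of $V=(V_1,V_2)$ given $X=x$ are identified (known); (c) for all $(d_1,d_2)\in\{0,1\}^2$, the instruments $Z=(Z_1,Z_2)$ are excluded from the structural functions $\mu_j^{(d_1,d_2)}$ and are independent of $(\varepsilon,U^{(d_1,d_2)})$ given $X$; and (d) for $j=1,2$, $Z_j$ contains a player-specific continuous variable such that $\pi_j^0(W_j)$ and $\pi_j^1(W_j)$ are non-degenerate and continuously distributed given $X$. Fix $x$. If $m^{(1,0)}(x,v_1,v_2)$, $m^{(0,1)}(x,v_1,v_2)$ and $h(v_1,v_2\mid x)$ are continuous in $(v_1,v_2)$, then $$m^{(1,0)}(x,p_1^0,p_2^1)=-\frac{1}{h(p_1^0,p_2^1\mid x)}\frac{\partial^2\psi^{(1,0)}(x,p_1^0,p_2^1)}{\partial p_1^0\,\partial p_2^1}\quad\text{for }(p_1^0,p_2^1)\in\operatorname{supp}[P_1^0,P_2^1\mid X=x,D=(1,0)],$$ $$m^{(0,1)}(x,p_1^1,p_2^0)=-\frac{1}{h(p_1^1,p_2^0\mid x)}\frac{\partial^2\psi^{(0,1)}(x,p_1^1,p_2^0)}{\partial p_1^1\,\partial p_2^0}\quad\text{for }(p_1^1,p_2^0)\in\operatorname{supp}[P_1^1,P_2^0\mid X=x,D=(0,1)],$$ so that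 these marginal treatment response functions are identified.
   Context: Two players $j\in\{1,2\}$ ($-j$ denotes the partner). Each has binary treatment $D_j\in\{0,1\}$; $D=(D_1,D_2)$. Potential outcomes $Y_j^{(d_j,d_{-j})}=\mu_j^{(d_j,d_{-j})}(X_j,U_j^{(d_j,d_{-j})})$ with observed covariates $X_j$, scalar unobservables $U_j^{(d_j,d_{-j})}$ and unknown functions $\mu_j^{(d_j,d_{-j})}$; observed outcome $Y_1=\sum_{d_1,d_2\in\{0,1\}}I^{(d_1,d_2)}Y_1^{(d_1,d_2)}$, where $I^{(d_1,d_2)}=\mathbf 1\{(D_1,D_2)=(d_1,d_2)\}$. Let $X=(X_1,X_2)$, $W_j=(X_j^\top,Z_j^\top)^\top$ with instruments $Z_j$, $\varepsilon=(\varepsilon_1,\varepsilon_2)$ continuously distributed, and $U^{(d_1,d_2)}=(U_1^{(d_1,d_2)},U_2^{(d_2,d_1)})$. Treatment decisions satisfy $D_j=\mathbf 1\{\pi_j(D_{-j},W_j)\ge\varepsilon_j\}$ for unknown $\pi_j$; write $\pi_j^d(\cdot)=\pi_j(d,\cdot)$. Define $V_j=F_{\varepsilon_j}(\varepsilon_j\mid X)$, $P_j^0=F_{\varepsilon_j}(\pi_j^0(W_j)\mid X)$, $P_j^1=F_{\varepsilon_j}(\pi_j^1(W_j)\mid X)$, with $F_{\varepsilon_j}(\cdot\mid X)$ the conditional CDF of $\varepsilon_j$ given $X$ (so $V_j\sim$ Uniform$[0,1]$ given $X$). Then $D_j=\mathbf 1\{P_j^0+D_{-j}(P_j^1-P_j^0)\ge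 V_j\}$, i.e. the realized $D$ is a pure-strategy Nash equilibrium of the complete-information game with payoffs $u_j(d_j,d_{-j})=d_j(P_j^0+d_{-j}(P_j^1-P_j^0)-V_j)$. Under complementarity this gives: $D=(1,0)\iff V_1\le P_1^0,\ V_2>P_2^1$; $D=(0,1)\iff V_1>P_1^1,\ V_2\le P_2^0$; $D=(1,1)\Rightarrow V_1\le P_1^1,\ V_2\le P_2^1$; $D=(0,0)\Rightarrow V_1>P_1^0,\ V_2>P_2^0$. Marginal treatment response (MTR) function: $m^{(d_1,d_2)}(x,p_1,p_2)=E[Y_1^{(d_1,d_2)}\mid X=x,V_1=p_1,V_2=p_2]$. Also $\psi^{(1,0)}(x,p_1^0,p_2^1)=E[I^{(1,0)}Y_1\mid X=x,P_1^0=p_1^0,P_2^1=p_2^1]$ and $\psi^{(0,1)}(x,p_1^1,p_2^0)=E[I^{(0,1)}Y_1\mid X=x,P_1^1=p_1^1,P_2^0=p_2^0]$, which are identified from the data.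
   Formalization: The formulas are proved at interior points of the stated supports where h is nonzero, with ψ the continuous version of the conditional expectation; at other support points the mixed derivative of ψ or 1/h is not well defined. *)

(* Defs.v *)
From HB Require Import structures.
From mathcomp Require Import all_boot all_order all_algebra.
From mathcomp Require Import all_classical all_reals all_analysis.
Set Implicit Arguments. Unset Strict Implicit. Unset Printing Implicit Defensive.
Import Order.TTheory GRing.Theory Num.Theory.
Import numFieldNormedType.Exports.
Local Open Scope classical_set_scope.
Local Open Scope ring_scope.

Definition indep_rv {R : realType} {d d1 d2 : measure_display}
  {Omega : measurableType d} {T1 : measurableType d1} {T2 : measurableType d2}
  (P : probability Omega R) (X : Omega -> T1) (Y : Omega -> T2) : Prop :=
  forall (A : set T1) (B : set T2), measurable A -> measurable B ->
    P (X @^-1` A `&` Y @^-1` B) = (P (X @^-1` A) * P (Y @^-1` B))%E.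

Definition cond_exp_version {R : realType} {d dT : measure_display}
  {Omega : measurableType d} {T : measurableType dT}
  (P : probability Omega R) (Y : Omega -> R) (G : Omega -> T) (g : T -> R)
  : Prop :=
  [/\ measurable_fun setT g,
      P.-integrable setT (fun w => (Y w)%:E),
      P.-integrable setT (fun w => (g (G w))%:E) &
      forall B : set T, measurable B ->
        (\int[P]_(w in G @^-1` B) (Y w)%:E =
         \int[P]_(w in G @^-1` B) (g (G w))%:E)%E].

Definition in_cond_support {R : realType} {d : measure_display}
  {Omega : measurableType d} (P : probability Omega R) (E : set Omega)
  (G : Omega -> R * R) (p : R * R) : Prop :=
  forall e : R, 0 < e -> (0 < P (E `&` G @^-1` ball p e))%E.

Definition in_cond_support_interior {R : realType} {d : measure_display}
  {Omega : measurableType d} (P : probability Omega R) (E : set Omega)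
  (G : Omega -> R * R) (p : R * R) : Prop :=
  \forall q \near p, in_cond_support P E G q.

Definition partial2 {R : realType} (f : R * R -> R) (p : R * R) : R :=
  derive1 (fun b => f (p.1, b)) p.2.

Definition mixed12 {R : realType} (f : R * R -> R) (p : R * R) : R :=
  derive1 (fun a => partial2 f (a, p.2)) p.1.

Definition mixed12_exists {R : realType} (f : R * R -> R) (p : R * R) : Prop :=
  (\forall a \near p.1, derivable (fun b => f (a, b)) p.2 1) /\
  derivable (fun a => partial2 f (a, p.2)) p.1 1.

Definition unit_square {R : realType} : set (R * R) :=
  [set v | 0 <= v.1 <= 1 /\ 0 <= v.2 <= 1].

(* Main.v *)
Require Import Defs.
From HB Require Import structures.
From mathcomp Require Import all_boot all_order all_algebra.
From mathcomp Require Import all_classical all_reals all_analysis.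
From mathcomp Require Import measurable_realfun ring lra.
Import Order.TTheory GRing.Theory Num.Theory.
Import numFieldNormedType.Exports.
Local Open Scope classical_set_scope.
Local Open Scope ring_scope.

(* Let G be the pair of thresholds that decide the treatment cell, e.g.
   (P_1^0, P_2^1) for the cell (1,0), and A q the region of V selecting the cell
   when G = q. On the event that G lies in a ball of radius e around q, the
   indicator of the cell equals 1{V in A q} except when V lies within e of the
   cross through q. Averaging over this event, the independence of G and (V, Y)
   and letting e tend to 0 give psi q = E[1{V in A q} Y] at every q in the support
   of G; no disintegration with respect to G is needed. By the definition of the
   MTR function m this is the integral of m h over A q within the unit square,
   i.e. the integral over a fixed strip minus the one over [0, q1] x [0, q2]. The
   strip term depends on a single coordinate of q, so the mixed derivative is
   - m h, by the fundamental theorem of calculus used twice. *)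

(** * Continuous functions on the plane *)

Lemma open_measurable2 (R : realType) (U : set (R * R)) : open U -> measurable U.
Proof.
move=> oU.
pose box (q : rat * rat * rat) : set (R * R) :=
  ball (ratr q.1.1 : R) (ratr q.2) `*` ball (ratr q.1.2 : R) (ratr q.2).
rewrite (_ : U = \bigcup_q (if `[< box q `<=` U >] then box q else set0)); last first.
  apply/seteqP; split => [u Uu|u [q _]]; last by case: ifPn => // /asboolP; exact.
  have /nbhs_ballP[e /= e0 eU] : nbhs u U by apply: open_nbhs_nbhs.
  have /rat_in_itvoo[r] : 0 < e / 2 by lra.
  rewrite in_itv/= => /andP[r0 re].
  have /rat_in_itvoo[a] : u.1 - ratr r < u.1 + ratr r by lra.
  rewrite in_itv/= => /andP[a1 a2].
  have /rat_in_itvoo[b] : u.2 - ratr r < u.2 + ratr r by lra.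
  rewrite in_itv/= => /andP[b1 b2].
  exists (a, b, r) => //; rewrite ifT; last first.
    apply/asboolP => -[x y] [/=]; rewrite /ball/= !ltr_distl => /andP[x1 x2] /andP[y1 y2].
    by apply: eU; split; rewrite /ball/= ltr_distl; lra.
  by split; rewrite /ball/= ltr_distl; lra.
apply: countable_bigcupT_measurable => // q; case: ifPn => // _.
by apply: measurableX; exact: measurable_ball.
Qed.

Lemma continuous2_measurable_fun (R : realType) (f : R * R -> R) :
  continuous f -> measurable_fun setT f.
Proof.
move=> /continuousP cf; apply: (measurability _ (RGenOpens.measurableE R)).
move=> _ [_ [a [b ->] <-]]; rewrite setTI; apply: open_measurable2.
exact/cf/interval_open.
Qed.

Lemma continuous_pair (T U V : topologicalType) (f : T -> U) (g : T -> V) x :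
  {for x, continuous f} -> {for x, continuous g} ->
  {for x, continuous (fun y => (f y, g y))}.
Proof.
move=> cf cg.
exact: (@cvg_pair _ _ _ (nbhs x) (nbhs (f x)) (nbhs (g x)) _ _ _ f g cf cg).
Qed.

Section clamp.
Variable R : realType.

(* m and h are only continuous on the closed unit square; composing with the
   retraction onto it gives a function continuous on the whole plane. *)
Definition clamp (x : R) : R := Num.max 0 (Num.min 1 x).
Definition clamp2 (v : R * R) : R * R := (clamp v.1, clamp v.2).

Lemma clamp_id x : 0 <= x <= 1 -> clamp x = x.
Proof. by move=> /andP[x0 x1]; rewrite /clamp min_r// max_r. Qed.

Lemma clamp2_id v : unit_square v -> clamp2 v = v.
Proof. by case: v => x y [/= x01 y01]; rewrite /clamp2 !clamp_id. Qed.

Lemma clamp_itv x : 0 <= clamp x <= 1.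
Proof. by rewrite /clamp le_max lexx/= ge_max ler01 ge_min lexx. Qed.

Lemma clamp2_square v : unit_square (clamp2 v).
Proof. by split; exact: clamp_itv. Qed.

Lemma continuous_clamp : continuous clamp.
Proof.
have c1 : continuous ((cst 1 : R -> R^o) \min (id : R -> R^o)).
  by move=> x; apply: continuous_min; [exact: cst_continuous|exact: cvg_id].
by move=> x; apply: (@continuous_max R R (cst 0) _ x); [exact: cst_continuous|exact: c1].
Qed.

Lemma continuous_clamp2 : continuous clamp2.
Proof.
move=> [a b]; apply: (@continuous_pair _ _ _ (clamp \o fst) (clamp \o snd));
  apply: continuous_comp.
- exact: (@cvg_fst _ _ (nbhs a) (nbhs b)).
- exact: continuous_clamp.
- exact: (@cvg_snd _ _ (nbhs a) (nbhs b)).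
- exact: continuous_clamp.
Qed.

Lemma continuous_comp_clamp2 (f : R * R -> R) :
  {within unit_square, continuous f} -> continuous (f \o clamp2).
Proof.
move=> /subspace_continuousP cf v.
have := cf _ (clamp2_square v); apply: cvg_comp => A.
rewrite /= withinE /= => -[B nB AB].
have : nbhs v (clamp2 @^-1` B) by exact: continuous_clamp2.
apply: filterS => u Bu.
have : (A `&` unit_square) (clamp2 u).
  by rewrite AB; split => //; exact: clamp2_square.
by case.
Qed.

End clamp.

Section rectangle_integral.
Variable R : realType.
Notation mu := (@lebesgue_measure R).
Variable g : R * R -> R.
Hypothesis cg : continuous g.

Definition row_int (a t : R) : R := \int[mu]_(s in `[0, a]) g (s, t).
Definition rect_int (a b : R) : R := \int[mu]_(t in `[0, b]) row_int a t.

Lemma continuous_row t : continuous (fun s => g (s, t)).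
Proof.
move=> s; apply: (@continuous_comp _ _ _ (fun s => (s, t)) g); last exact: cg.
by apply: continuous_pair; [exact: cvg_id|exact: cvg_cst].
Qed.

Lemma continuous_col s : continuous (fun t => g (s, t)).
Proof.
move=> t; apply: (@continuous_comp _ _ _ (fun t => (s, t)) g); last exact: cg.
by apply: continuous_pair; [exact: cvg_cst|exact: cvg_id].
Qed.

Lemma continuous_row_int a : continuous (row_int a).
Proof.
move=> t.
have : compact (`[0, a] `*` `[t - 1, t + 1]).
  by apply: compact_setX; exact: segment_compact.
move=> /(continuous_compact (continuous_subspaceT cg)) /compact_bounded[M [_ gM]].
have {}gM s r : 0 <= s <= a -> t - 1 <= r <= t + 1 -> `|g (s, r)| <= M + 1.
  move=> sa rt; apply: (gM (M + 1)); first by rewrite ltrDl.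
  by exists (s, r) => //; split; rewrite /= in_itv.
have mB : measurable `[0, a] by [].
have H := @continuity_under_integral R _ _ mu (fun t s => g (s, t)) _ mB
  (t - 1) (t + 1).
apply: (H _ _ (cst (M + 1))).
- move=> r _; apply: continuous_compact_integrable; first exact: segment_compact.
  exact/continuous_subspaceT/continuous_row.
- by apply: aeW => s _ r _; exact: continuous_col.
- apply: continuous_compact_integrable; first exact: segment_compact.
  exact/continuous_subspaceT/cst_continuous.
- move=> r; rewrite /= in_itv/= => /andP[r1 r2]; apply: aeW => s.
  by rewrite /= in_itv/= => sa; apply: gM; rewrite ?(ltW r1) ?(ltW r2).
- by rewrite inE/= in_itv/=; lra.
Qed.

Lemma derive_rect_int (a b : R) : 0 < b ->
  is_derive b (1 : R) (rect_int a) (row_int a b).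
Proof.
move=> b0; have bb : b < b + 1 by lra.
have [] := @continuous_FTC1 R (row_int a) (BLeft 0) b (b + 1) bb.
- apply: continuous_compact_integrable; first exact: segment_compact.
  exact/continuous_subspaceT/continuous_row_int.
- by rewrite lte_fin.
- exact: continuous_row_int.
move=> d e; apply: DeriveDef; first exact: d.
by rewrite -derive1E; exact: e.
Qed.

Lemma derive_row_int (a b : R) : 0 < a ->
  is_derive a (1 : R) (row_int ^~ b) (g (a, b)).
Proof.
move=> a0; have aa : a < a + 1 by lra.
have [] := @continuous_FTC1 R (fun s => g (s, b)) (BLeft 0) a (a + 1) aa.
- apply: continuous_compact_integrable; first exact: segment_compact.
  exact/continuous_subspaceT/continuous_row.
- by rewrite lte_fin.
- exact: continuous_row.
move=> d e; apply: DeriveDef; first exact: d.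
by rewrite -derive1E; exact: e.
Qed.

End rectangle_integral.
Arguments row_int {R}.
Arguments rect_int {R}.

(** * Integrals over rectangles and densities *)

Section mixed_partials.
Variable R : realType.

Lemma near_curry (p : R * R) (Q : R -> R -> Prop) :
  (\forall q \near p, Q q.1 q.2) ->
  \forall a \near p.1, \forall b \near p.2, Q a b.
Proof.
case: p => p1 p2 [[A B] /= [nA nB] AB].
apply: filterS nA => a Aa; apply: filterS nB => b Bb.
exact: (AB (a, b)).
Qed.

Lemma mixed12_rect_int (g psi : R * R -> R) (C : R -> R -> R) (c : R -> R) (p : R * R) :
  continuous g -> 0 < p.1 -> 0 < p.2 ->
  (forall a b : R, 0 < b -> is_derive b (1 : R) (C a) (c b)) ->
  (\forall q \near p, psi q = C q.1 q.2 - rect_int g q.1 q.2) ->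
  mixed12_exists psi p /\ mixed12 psi p = - g p.
Proof.
move=> cg p10 p20 dC psiE.
have {}psiE : \forall a \near p.1, \forall b \near p.2,
    C a b - rect_int g a b = psi (a, b).
  by apply: near_curry; apply: filterS psiE => -[a b] /= ->.
have d2 : \forall a \near p.1,
    is_derive p.2 (1 : R) (fun b => psi (a, b)) (c p.2 - row_int g a p.2).
  apply: filterS psiE => a; move/near_eq_is_derive; apply.
  have d1 := dC a _ p20.
  have d2 := derive_rect_int _ _ cg a _ p20.
  exact: is_deriveB.
have p2E : \forall a \near p.1, c p.2 - row_int g a p.2 = partial2 psi (a, p.2).
  by apply: filterS d2 => a [_ <-]; rewrite /partial2 derive1E.
have d12 : is_derive p.1 (1 : R) (fun a => partial2 psi (a, p.2)) (- g p).
  move/near_eq_is_derive : p2E; apply.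
  have d1 := is_derive_cst (c p.2 : R) p.1 (1 : R).
  have d3 := derive_row_int _ _ cg _ p.2 p10.
  have := is_deriveB d1 d3; rewrite sub0r -surjective_pairing; exact.
split; first split.
- by apply: filterS d2 => a [].
- by case: d12.
- by rewrite /mixed12 derive1E; case: d12.
Qed.

End mixed_partials.

Section fubini_rectangle.
Variable R : realType.
Notation mu := (@lebesgue_measure R).
Variable g : R * R -> R.
Hypothesis cg : continuous g.

Lemma integrable_rectangle a b :
  (mu \x mu)%E.-integrable (`[0, a] `*` `[0, b]) (EFin \o g).
Proof.
have mAB : measurable (`[0, a]%classic `*` `[0, b]%classic) by exact: measurableX.
apply: measurable_bounded_integrable => //.
- rewrite [X in (X < _)%E](product_measure1E mu mu)//= !lebesgue_measure_itv/=.
  by do 2 case: ifPn => _; rewrite ?mul0e ?mule0// -!EFinB -EFinM ltry.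
- exact: measurable_funTS (continuous2_measurable_fun _ _ cg).
- have : compact (`[0, a] `*` `[0, b]).
    by apply: compact_setX; exact: segment_compact.
  move=> /(continuous_compact (continuous_subspaceT cg)) /compact_bounded[M [Mr gM]].
  by exists M; split=> // x /gM gx y AB; apply: gx; exists y.
Qed.

Lemma integral_rectangle a b :
  (\int[mu \x mu]_(v in `[0%R, a] `*` `[0%R, b]) (g v)%:E = (rect_int g a b)%:E)%E.
Proof.
have mAB : measurable (`[0, a]%classic `*` `[0, b]%classic) by exact: measurableX.
have /integrable_mkcond ig := integrable_rectangle a b.
rewrite integral_mkcond -integral21_prod_meas1; last first.
  exact: (ig mAB).
have rowE t : (\int[mu]_(s in `[0%R, a]) (g (s, t))%:E = (row_int g a t)%:E)%E.
  rewrite /row_int /Rintegral fineK//; apply: integrable_fin_num => //.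
  apply: continuous_compact_integrable; first exact: segment_compact.
  exact/continuous_subspaceT/continuous_row.
rewrite /rect_int /Rintegral fineK; last first.
  apply: integrable_fin_num => //.
  apply: continuous_compact_integrable; first exact: segment_compact.
  exact/continuous_subspaceT/continuous_row_int.
rewrite [RHS]integral_mkcond; apply: eq_integral => t _.
rewrite /fubini_G !patchE; case: ifPn => tb.
  rewrite -rowE [RHS]integral_mkcond; apply: eq_integral => s _.
  by rewrite !patchE in_setX/= tb andbT.
by rewrite integral0_eq// => s _; rewrite patchE in_setX/= (negbTE tb) andbF.
Qed.

End fubini_rectangle.

Section density.
Local Open Scope ereal_scope.
Context d1 d2 (Omega : measurableType d1) (T : measurableType d2) (R : realType).
Variables (P : probability Omega R) (mu : {sigma_finite_measure set T -> \bar R}).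
Variables (V : Omega -> T) (h : T -> R) (S : set T).
Hypothesis mV : measurable_fun setT V.
Hypothesis mS : measurable S.
Hypothesis VS : forall w, S (V w).
Hypothesis mh : measurable_fun S h.
Hypothesis Vh : forall A, measurable A ->
  P (V @^-1` A) = \int[mu]_(v in A) (h v)%:E.

Lemma density_null A : measurable A -> mu A = 0 -> P (V @^-1` A) = 0.
Proof.
move=> mA A0.
rewrite (_ : V @^-1` A = V @^-1` (A `&` S)); last first.
  by apply/seteqP; split => [w Aw|w []]; first split.
rewrite Vh; last exact: measurableI.
apply: null_set_integral; first exact: measurableI.
  by apply/measurable_EFinP; apply: measurable_funS mh => //; exact: subIsetr.
by apply: subset_measure0 A0 => //; exact: measurableI.
Qed.

Let V_mixin := isMeasurableFun.Build _ _ _ _ _ mV.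
Let V_mfun : {mfun _ >-> _} := HB.pack V V_mixin.

Lemma integral_density (f : T -> R) (A : set T) :
  measurable_fun setT f -> P.-integrable setT (fun w => (f (V w))%:E) ->
  measurable A -> A `<=` S ->
  \int[P]_(w in V @^-1` A) (f (V w))%:E = \int[mu]_(v in A) (f v * h v)%:E.
Proof.
move=> mf fi mA AS.
pose nu : probability T R := distribution P V_mfun.
have numu : nu `<< mu by apply/null_content_dominatesP; exact: density_null.
have mVA : measurable (V @^-1` A) by rewrite -[_ @^-1` _]setTI; exact: mV.
have mef : measurable_fun setT (EFin \o f) by exact/measurable_EFinP.
have fiA : P.-integrable (V @^-1` A) ((EFin \o f) \o V).
  by apply: integrableS fi.
transitivity (\int[nu]_(v in A) (EFin \o f) v).
  by rewrite (integral_pushforward mV).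
rewrite -(Radon_Nikodym_change_of_variables numu mA); last first.
  exact: (integrable_pushforward mV).
have mfA : measurable_fun A f by exact: measurable_funTS.
have mhA : measurable_fun A h by exact: measurable_funS mh.
apply: ae_eq_integral => //.
- apply: emeasurable_funM; first exact/measurable_EFinP.
  exact: measurable_funTS.
- exact/measurable_EFinP/measurable_funM.
- under [X in ae_eq _ _ _ X]eq_fun do rewrite EFinM.
  apply: ae_eqe_mul2l; apply: integral_ae_eq => //.
  + by apply: (integrableS measurableT) => //; exact: Radon_Nikodym_integrable.
  + exact/measurable_EFinP.
  + move=> B BA mB.
    by rewrite -Radon_Nikodym_integral//= -Vh.
Qed.

End density.

Arguments density_null {d1 d2 Omega T R P mu V h S}.
Arguments integral_density {d1 d2 Omega T R P mu V h S}.

(** * Regression functions on their support *)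

Lemma ae_le_normr_Rintegral d (T : measurableType d) (R : realType)
    (mu : {measure set T -> \bar R}) (D : set T) (f g : T -> R) :
  measurable D -> mu.-integrable D (EFin \o f) -> mu.-integrable D (EFin \o g) ->
  (forall x, D x -> 0 <= g x) ->
  {ae mu, forall x, D x -> `|f x| <= g x} ->
  `|\int[mu]_(x in D) f x| <= \int[mu]_(x in D) g x.
Proof.
move=> mD fi gi g0 fg; apply: (le_trans (le_normr_Rintegral mD fi)).
have fi' : mu.-integrable D (EFin \o (fun x => `|f x|)) by exact: integrable_norm fi.
rewrite /Rintegral fine_le//; [exact: integrable_fin_num..|].
apply: ae_ge0_le_integral => //.
- exact: measurable_int fi'.
- exact: measurable_int gi.
Qed.

Section independence.
Context d d1 d2 (Omega : measurableType d) (T1 : measurableType d1)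
  (T2 : measurableType d2) (R : realType) (P : probability Omega R).
Variables (Z : Omega -> T1) (W : Omega -> T2).
Hypothesis mZ : measurable_fun setT Z.
Hypothesis mW : measurable_fun setT W.
Hypothesis ZW : indep_rv P Z W.

Lemma indep_rv_comp d3 d4 (T3 : measurableType d3) (T4 : measurableType d4)
    (f : T1 -> T3) (g : T2 -> T4) :
  measurable_fun setT f -> measurable_fun setT g -> indep_rv P (f \o Z) (g \o W).
Proof.
move=> mf mg A B mA mB; apply: (ZW (f @^-1` A) (g @^-1` B)).
- by rewrite -[_ @^-1` _]setTI; exact: mf.
- by rewrite -[_ @^-1` _]setTI; exact: mg.
Qed.

Let mZB B : measurable B -> measurable (Z @^-1` B).
Proof. by move=> mB; rewrite -[_ @^-1` _]setTI; exact: mZ. Qed.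

Let W_mixin := isMeasurableFun.Build _ _ _ _ _ mW.
Let W_mfun : {mfun _ >-> _} := HB.pack W W_mixin.

Lemma ge0_indep_integral (B : set T1) (f : T2 -> \bar R) :
  measurable B -> measurable_fun setT f -> (forall x, 0 <= f x)%E ->
  (\int[P]_(w in Z @^-1` B) f (W w) = P (Z @^-1` B) * \int[P]_w f (W w))%E.
Proof.
move=> mB mf f0; have mD := mZB B mB; set D := Z @^-1` B.
have mfW : measurable_fun setT (f \o W) by exact: measurableT_comp.
pose Q := mrestr P mD.
rewrite (eq_measure_integral Q); last first.
  by move=> A mA AD; rewrite /Q/= /mrestr setIidl.
transitivity (\int[Q]_w f (W w))%E.
  rewrite [RHS](@ge0_negligible_integral _ _ _ Q setT (~` D))//.
  - by rewrite setTD setCK.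
  - exact: measurableC.
  - by rewrite /Q/= /mrestr setICl measure0.
rewrite -(@ge0_integral_pushforward _ _ _ _ _ _ mW Q setT f)//; last first.
have p0 : 0 <= fine (P D) by rewrite fine_ge0.
have PD : P D \is a fin_num by rewrite fin_num_measure.
rewrite (eq_measure_integral (mscale (NngNum p0) (distribution P W_mfun))); last first.
  move=> A mA _; rewrite /= /mscale/= fineK// /pushforward/= /mrestr setIC.
  exact: ZW.
rewrite ge0_integral_mscale//= fineK//; congr (_ * _)%E.
by rewrite (@ge0_integral_distribution _ _ _ _ _ P W_mfun).
Qed.

Lemma indep_Rintegral (B : set T1) (f : T2 -> R) :
  measurable B -> measurable_fun setT f ->
  P.-integrable setT (fun w => (f (W w))%:E) ->
  \int[P]_(w in Z @^-1` B) f (W w) = fine (P (Z @^-1` B)) * \int[P]_w f (W w).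
Proof.
move=> mB mf fi; have mD := mZB B mB.
have PD : P (Z @^-1` B) \is a fin_num by rewrite fin_num_measure.
have fiD : P.-integrable (Z @^-1` B) (fun w => (f (W w))%:E) by exact: integrableS fi.
have mef : measurable_fun setT (EFin \o f) by exact/measurable_EFinP.
rewrite /Rintegral -[fine (P _) * _]fineM//; last exact: integrable_fin_num.
have pos_int := ge0_indep_integral B _ mB (measurable_funepos mef) (funepos_ge0 _).
have neg_int := ge0_indep_integral B _ mB (measurable_funeneg mef) (funeneg_ge0 _).
congr fine; rewrite integralE [in RHS]integralE muleBr//; last first.
  apply: fin_num_adde_defl; rewrite fin_numN; apply: integrable_fin_num => //.
  exact: integrable_funeneg.
congr (_ - _)%E.
- transitivity (\int[P]_(w in Z @^-1` B) (EFin \o f)^\+%E (W w))%E.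
    by apply: eq_integral => w _; exact: (congr1 (@^~ w) (funepos_comp (EFin \o f) W)).
  rewrite pos_int; congr (_ * _)%E.
  by apply: eq_integral => w _; exact/esym/(congr1 (@^~ w) (funepos_comp (EFin \o f) W)).
- transitivity (\int[P]_(w in Z @^-1` B) (EFin \o f)^\-%E (W w))%E.
    by apply: eq_integral => w _; exact: (congr1 (@^~ w) (funeneg_comp (EFin \o f) W)).
  rewrite neg_int; congr (_ * _)%E.
  by apply: eq_integral => w _; exact/esym/(congr1 (@^~ w) (funeneg_comp (EFin \o f) W)).
Qed.

End independence.
Arguments indep_rv_comp {d d1 d2 Omega T1 T2 R P Z W}.
Arguments indep_Rintegral {d d1 d2 Omega T1 T2 R P Z W}.

Section regression.
Context d (Omega : measurableType d) (R : realType) (P : probability Omega R).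
Variables (G V : Omega -> R * R) (Y J : Omega -> R) (psi : R * R -> R).
Variables (A : set (R * R)) (q : R * R).

Definition cross (e : R) : set (R * R) :=
  [set v | `|v.1 - q.1| <= e \/ `|v.2 - q.2| <= e].

Lemma measurable_cross e : measurable (cross e).
Proof.
have -> : cross e = (`[q.1 - e, q.1 + e] `*` setT) `|` (setT `*` `[q.2 - e, q.2 + e]).
  apply/seteqP; split=> [v|v]; rewrite /cross/= !in_itv/= !ler_distl.
    by case; [left|right].
  by case=> -[]; [left|right].
by apply: measurableU; exact: measurableX.
Qed.

Hypothesis mG : measurable_fun setT G.
Hypothesis mV : measurable_fun setT V.
Hypothesis mY : measurable_fun setT Y.
Hypothesis mA : measurable A.
Hypothesis GVY : indep_rv P G (fun w => (V w, Y w)).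
Hypothesis Yi : P.-integrable setT (fun w => (Y w)%:E).
Hypothesis psiJ : cond_exp_version P J G psi.
Hypothesis cpsi : {for q, continuous psi}.
Hypothesis Gq : forall e, 0 < e -> (0 < P (G @^-1` ball q e))%E.
Hypothesis V0 : P (V @^-1` cross 0) = 0%E.
Hypothesis JY : forall e, 0 < e -> {ae P, forall w, ball q e (G w) ->
  `|J w - \1_A (V w) * Y w| <= \1_(cross e) (V w) * `|Y w|}.

Let mVY : measurable_fun setT (fun w => (V w, Y w)).
Proof. exact: measurable_fun_pair. Qed.

Let integrable_indicY (B : set (R * R)) : measurable B ->
  P.-integrable setT (fun w => (\1_B (V w) * Y w)%:E).
Proof.
move=> mB; apply: le_integrable Yi => //.
  apply/measurable_EFinP/measurable_funM => //.
  by apply: (measurableT_comp _ mV); exact: measurable_indic.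
move=> w _; rewrite lee_fin normrM indicE.
by case: (_ \in _); rewrite ?normr1 ?mul1r// normr0 mul0r.
Qed.

Let integrable_indicnY (B : set (R * R)) : measurable B ->
  P.-integrable setT (fun w => (\1_B (V w) * `|Y w|)%:E).
Proof.
move=> mB; have := integrable_norm (integrable_indicY B mB).
apply: eq_integrable => // w _; rewrite /= normrM indicE.
by case: (_ \in _); rewrite ?normr1 ?normr0.
Qed.

Let tail_cvg0 :
  \int[P]_w (\1_(cross n.+1%:R^-1) (V w) * `|Y w|) @[n --> \oo] --> (0 : R).
Proof.
have mc n : measurable_fun setT (fun w => (\1_(cross n.+1%:R^-1) (V w) * `|Y w|)%:E).
  exact: measurable_int (integrable_indicnY _ (measurable_cross _)).
have c0 : measurable_fun [set: Omega] (fun=> 0%:E : \bar R) by exact: measurable_cst.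
have := @dominated_convergence _ _ _ P setT measurableT
  (fun n w => (\1_(cross n.+1%:R^-1) (V w) * `|Y w|)%:E) (fun=> 0%:E)
  (fun w => `|(Y w)%:E|%E) mc c0.
case.
- exists (V @^-1` cross 0); split => //.
    by rewrite -[_ @^-1` _]setTI; apply: mV => //; exact: measurable_cross.
  move=> w /= Nw; apply: contrapT => ncross; apply: Nw => _.
  have [v1 v2] : 0 < `|(V w).1 - q.1| /\ 0 < `|(V w).2 - q.2|.
    by split; rewrite ltNge; apply/negP => vq; apply: ncross; [left|right].
  pose m := Num.min `|(V w).1 - q.1| `|(V w).2 - q.2|.
  have m0 : 0 < m by rewrite lt_min v1 v2.
  apply: cvg_near_cst; near=> n.
  rewrite indicE memNset ?mul0r// => -[].
    apply/negP; rewrite -ltNge; apply: (@lt_le_trans _ _ m); last by rewrite ge_min lexx.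
    by near: n; exact: near_infty_natSinv_lt (PosNum m0).
  apply/negP; rewrite -ltNge; apply: (@lt_le_trans _ _ m); last by rewrite ge_min lexx orbT.
  by near: n; exact: near_infty_natSinv_lt (PosNum m0).
- exact: integrable_abse.
- apply: aeW => w n _; rewrite /= lee_fin normrM normr_id indicE.
  by case: (_ \in _); rewrite ?normr1 ?mul1r// normr0 mul0r.
move=> _ _; rewrite integral0 => /fine_cvgP[_]; exact.
Unshelve. all: by end_near. Qed.

Lemma regression_eq : psi q = \int[P]_w (\1_A (V w) * Y w).
Proof.
have [mpsi Ji psii psiE] := psiJ.
set Phi := RHS.
suff H : forall del, 0 < del -> `|psi q - Phi| <= del + del.
  apply/eqP; rewrite -subr_eq0 -normr_le0; apply/ler_addgt0Pr => e e0.
  by rewrite add0r; apply: (le_trans (H (e / 2) _)); lra.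
move=> del del0.
have [e0 /= e00 psidel] : \forall e \near (0 : R)^'+, forall v, ball q e v ->
    `|psi q - psi v| <= del.
  move/cvgrPdist_le : cpsi => /(_ _ del0) /nbhs_ballP[e /= e0 eq].
  near=> e' => v qv; apply: eq; apply: le_ball qv.
  by near: e'; exact: nbhs_right_le.
have [n [ne0 rn]] : exists n, n.+1%:R^-1 < e0 /\
    \int[P]_w (\1_(cross n.+1%:R^-1) (V w) * `|Y w|) <= del.
  move/cvgrPdist_le : tail_cvg0 => /(_ _ del0) rdel.
  near \oo => n; exists n; split.
    by near: n; exact: near_infty_natSinv_lt (PosNum e00).
  apply: (le_trans (ler_norm _)); rewrite -normrN -sub0r.
  by near: n.
set e : R := n.+1%:R^-1 in ne0 rn *.
have e_gt0 : 0 < e by rewrite invr_gt0.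
have {}psidel v : ball q e v -> `|psi q - psi v| <= del.
  by apply: psidel => //=; rewrite sub0r normrN gtr0_norm.
pose D := G @^-1` ball q e; set c := fine (P D).
have mb : measurable (ball q e).
  rewrite (_ : ball q e = ball q.1 e `*` ball q.2 e)//.
  by apply: measurableX; exact: measurable_ball.
have mD : measurable D by rewrite /D -[_ @^-1` _]setTI; exact: mG.
have c0 : 0 < c by rewrite fine_gt0// Gq//= ltey_eq fin_num_measure.
have iD f : P.-integrable setT f -> P.-integrable D f by exact: integrableS.
have iA := iD _ (integrable_indicY _ mA).
have iN := iD _ (integrable_indicnY _ (measurable_cross e)).
have iJ := iD _ Ji. have ipsi := iD _ psii.
have icst k : P.-integrable D (EFin \o cst k).
  by apply: iD; exact: finite_measure_integrable_cst.
have E1 : \int[P]_(w in D) psi (G w) = \int[P]_(w in D) J w.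
  by rewrite /Rintegral -psiE.
have E2 : \int[P]_(w in D) (\1_A (V w) * Y w) = c * Phi.
  apply: (indep_Rintegral mG mVY GVY _
    (fun x => \1_A x.1 * x.2)) => //; last exact: integrable_indicY.
  apply: measurable_funM => //.
  by apply: (measurableT_comp _ measurable_fst); exact: measurable_indic.
have E3 : \int[P]_(w in D) (\1_(cross e) (V w) * `|Y w|) =
    c * \int[P]_w (\1_(cross e) (V w) * `|Y w|).
  apply: (indep_Rintegral mG mVY GVY _
    (fun x => \1_(cross e) x.1 * `|x.2|)) => //;
    last by apply: integrable_indicnY; exact: measurable_cross.
  apply: measurable_funM; last exact: measurableT_comp.
  apply: (measurableT_comp _ measurable_fst).
  by apply: measurable_indic; exact: measurable_cross.
have B1 : `|\int[P]_(w in D) (psi q - psi (G w))| <= del * c.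
  rewrite -(Rintegral_cst P mD); apply: ae_le_normr_Rintegral => //.
  - exact: (integrableB mD (icst _) ipsi).
  - exact: icst.
  - by move=> w _; exact: ltW.
  - by apply: aeW => w; exact: psidel.
have B2 : `|\int[P]_(w in D) (J w - \1_A (V w) * Y w)| <= c * del.
  apply: (@le_trans _ _ (c * \int[P]_w (\1_(cross e) (V w) * `|Y w|))); last first.
    by rewrite ler_pM2l.
  rewrite -E3; apply: ae_le_normr_Rintegral => //.
  - exact: (integrableB mD iJ iA).
  - exact: (JY _ e_gt0).
rewrite -(ler_pM2r c0) -[X in _ * X](gtr0_norm c0) -normrM.
have -> : (psi q - Phi) * c = \int[P]_(w in D) (psi q - psi (G w)) +
    \int[P]_(w in D) (J w - \1_A (V w) * Y w).
  rewrite (RintegralB mD (icst (psi q)) ipsi) (RintegralB mD iJ iA) E1 E2 (Rintegral_cst P mD) -/c.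
  by ring.
apply: (le_trans (ler_normD _ _)); rewrite mulrDl; apply: lerD => //.
by rewrite mulrC.
Unshelve. all: by end_near. Qed.

End regression.

(** * The derivative formula for one treatment cell *)

(* The constant is only there to carry a sigma-finite structure, which instance
   resolution does not find on the bare product. *)
Definition lebesgue2 (R : realType) :
    set (measurableTypeR R * measurableTypeR R)%type -> \bar R :=
  ((@lebesgue_measure R) \x (@lebesgue_measure R))%E.

HB.instance Definition _ (R : realType) := Measure.on (lebesgue2 R).

Lemma lebesgue2_sigma_finite (R : realType) : sigma_finite [set: R * R] (lebesgue2 R).
Proof.
exists (fun n => `[- n%:R, n%:R] `*` `[- n%:R, n%:R]) => [|n].
  apply/seteqP; split => // -[x y] _.
  have xy := ltW (truncnS_gt (Num.max `|x| `|y|)).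
  exists (Num.truncn (Num.max `|x| `|y|)).+1 => //=.
  by move: xy; rewrite ge_max !in_itv/= -!ler_norml => /andP[].
split; first exact: measurableX.
rewrite [X in (X < _)%E](product_measure1E (@lebesgue_measure R) (@lebesgue_measure R))//=.
rewrite !lebesgue_measure_itv/=.
by case: ifPn => _; rewrite ?mul0e// -!EFinB -EFinM ltry.
Qed.

HB.instance Definition _ (R : realType) :=
  Measure_isSigmaFinite.Build _ _ _ (lebesgue2 R) (lebesgue2_sigma_finite R).

Lemma continuousM_clamp2 (R : realType) (f1 f2 : R * R -> R) :
  {within unit_square, continuous f1} -> {within unit_square, continuous f2} ->
  continuous ((fun v => f1 v * f2 v) \o @clamp2 R).
Proof.
by move=> cf1 cf2 v; apply: cvgM;
  [exact: (continuous_comp_clamp2 _ _ cf1)|exact: (continuous_comp_clamp2 _ _ cf2)].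
Qed.

Section unit_square.
Variable R : realType.
Notation lambda2 := (lebesgue2 R).

Lemma unit_squareE : @unit_square R = `[0, 1] `*` `[0, 1].
Proof. by apply/seteqP; split=> v; rewrite /unit_square/= !in_itv. Qed.

Lemma measurable_unit_square : measurable (@unit_square R).
Proof. by rewrite unit_squareE; exact: measurableX. Qed.

Lemma within_square_measurable (f : R * R -> R) :
  {within unit_square, continuous f} -> measurable_fun unit_square f.
Proof.
move=> /continuous_comp_clamp2 /continuous2_measurable_fun mf.
apply: (eq_measurable_fun (f \o @clamp2 R)).
  by move=> v /set_mem vS; rewrite /= clamp2_id.
exact: measurable_funTS.
Qed.

Lemma lebesgue_cross0 (q : R * R) : lambda2 (cross R q 0) = 0%E.
Proof.
have cE : cross R q 0 `<=` ([set q.1] `*` setT) `|` (setT `*` [set q.2]).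
  move=> v []; rewrite normr_le0 subr_eq0 => /eqP vq; [left|right] => //.
pose mu : {measure set (measurableTypeR R * measurableTypeR R) -> \bar R} := lambda2.
have mR (x : R) : measurable ([set x] `*` [set: R]) by exact: measurableX.
have mL (x : R) : measurable ([set: R] `*` [set x]) by exact: measurableX.
have m1 (x : R) : mu ([set x] `*` [set: R]) = 0%E.
  rewrite [LHS]product_measure1E//.
  by rewrite [X in (X * _)%E]lebesgue_measure_set1 mul0e.
have m2 (x : R) : mu ([set: R] `*` [set x]) = 0%E.
  rewrite [LHS]product_measure1E//.
  by rewrite [X in (_ * X)%E]lebesgue_measure_set1 mule0.
have mu0 := @null_set_setU _ _ _ mu _ _ (mR q.1) (mL q.2) (m1 q.1) (m2 q.2).
apply: (@subset_measure0 _ _ _ mu _ _ _ _ cE mu0); first exact: measurable_cross.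
by apply: measurableU; [exact: mR|exact: mL].
Qed.

Variable g : R * R -> R.
Hypothesis cg : continuous g.

Lemma Rintegral_rectangleD (A : set (R * R)) (a b a' b' : R) :
  measurable A ->
  `[0, a'] `*` `[0, b'] = A `|` `[0, a] `*` `[0, b] ->
  [disjoint A & `[0, a] `*` `[0, b]] ->
  \int[lambda2]_(v in A) g v = rect_int g a' b' - rect_int g a b.
Proof.
move=> mA AE A0.
have rectE s t : \int[lambda2]_(v in `[0, s] `*` `[0, t]) g v = rect_int g s t.
  by rewrite /Rintegral integral_rectangle.
rewrite -!rectE AE Rintegral_setU//; first by rewrite addrK.
- exact: measurableX.
- by rewrite -AE; exact: integrable_rectangle.
Qed.

End unit_square.

Lemma cond_support_closed (R : realType) (d : measure_display)
    (Omega : measurableType d) (P : probability Omega R) (E : set Omega)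
    (G : Omega -> R * R) (q : R * R) :
  (forall w, unit_square (G w)) -> in_cond_support P E G q -> unit_square q.
Proof.
move=> GS Eq.
have near_square e : 0 < e -> exists2 v : R * R, unit_square v & ball q e v.
  move=> e0; have := Eq e e0; rewrite lt0e => /andP[/eqP + _].
  apply: contra_notP => nv; rewrite (_ : _ `&` _ = set0) ?measure0//.
  by apply/seteqP; split=> // w [_ Gw]; apply: nv; exists (G w).
split; apply/andP; split; rewrite leNgt; apply/negP => q01.
- have [|v [/andP[v1 _] _] [+ _]] := near_square (- q.1); first lra.
  by rewrite /ball/= ltr_distl => /andP[]; lra.
- have [|v [/andP[_ v1] _] [+ _]] := near_square (q.1 - 1); first lra.
  by rewrite /ball/= ltr_distl => /andP[]; lra.
- have [|v [_ /andP[v2 _]] [_ +]] := near_square (- q.2); first lra.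
  by rewrite /ball/= ltr_distl => /andP[]; lra.
- have [|v [_ /andP[_ v2]] [_ +]] := near_square (q.2 - 1); first lra.
  by rewrite /ball/= ltr_distl => /andP[]; lra.
Qed.

Lemma near_unit_square_gt0 (R : realType) (p : R * R) :
  (\forall q \near p, unit_square q) -> 0 < p.1 /\ 0 < p.2.
Proof.
move=> /nbhs_ballP[e /= e0 eS].
have [] : unit_square (p.1 - e / 2, p.2 - e / 2).
  by apply: eS; split; rewrite /ball/= ltr_distl; lra.
by move=> /= /andP[? _] /andP[? _]; lra.
Qed.

Section mtr_formula.
Context d (Omega : measurableType d) (R : realType) (P : probability Omega R).
Notation lambda2 := (lebesgue2 R).
Variables (G V : Omega -> R * R) (Y J : Omega -> R) (h m psi : R * R -> R).
Variables (A : R * R -> set (R * R)) (C : R -> R -> R) (c : R -> R).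
Variable E : set Omega.

Let g := (fun v => m v * h v) \o @clamp2 R.

Hypothesis mG : measurable_fun setT G.
Hypothesis mV : measurable_fun setT V.
Hypothesis mY : measurable_fun setT Y.
Hypothesis mA : forall q, measurable (A q).
Hypothesis mE : measurable E.
Hypothesis GS : forall w, unit_square (G w).
Hypothesis VS : forall w, unit_square (V w).
Hypothesis Vh : forall B : set (R * R), measurable B ->
  P (V @^-1` B) = (\int[lambda2]_(v in B) (h v)%:E)%E.
Hypothesis GVY : indep_rv P G (fun w => (V w, Y w)).
Hypothesis Ym : cond_exp_version P Y V m.
Hypothesis Jpsi : cond_exp_version P J G psi.
Hypothesis cpsi : continuous psi.
Hypothesis cm : {within unit_square, continuous m}.
Hypothesis ch : {within unit_square, continuous h}.
Hypothesis JY : forall q e, 0 < e -> {ae P, forall w, ball q e (G w) ->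
  `|J w - \1_(A q) (V w) * Y w| <= \1_(cross R q e) (V w) * `|Y w|}.
Hypothesis intA : forall q, unit_square q ->
  \int[lambda2]_(v in A q `&` unit_square) g v = C q.1 q.2 - rect_int g q.1 q.2.
Hypothesis dC : forall a b : R, 0 < b -> is_derive b (1 : R) (C a) (c b).

Let cg : continuous g := continuousM_clamp2 _ _ _ cm ch.

Lemma regression_rect q : in_cond_support P E G q ->
  psi q = C q.1 q.2 - rect_int g q.1 q.2.
Proof.
move=> Eq; have qS := cond_support_closed _ _ _ _ _ _ _ GS Eq.
have [mm Yi mVi YmE] := Ym.
have mh := within_square_measurable _ _ ch.
have mS := measurable_unit_square R.
have mGball e : measurable (G @^-1` ball q e).
  rewrite -[_ @^-1` _]setTI; apply: mG => //.
  rewrite (_ : ball q e = ball q.1 e `*` ball q.2 e)//.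
  by apply: measurableX; exact: measurable_ball.
have V0 := @density_null _ _ Omega _ R P (lebesgue2 R) V h unit_square mS VS mh Vh
  _ (measurable_cross _ q 0) (lebesgue_cross0 R q).
rewrite (@regression_eq _ _ _ P G V Y J psi (A q) q)//; last 3 first.
- exact: cpsi.
- move=> e /Eq /lt_le_trans; apply; apply: le_measure; rewrite ?inE//.
  exact: measurableI.
- exact: JY.
rewrite -intA// /Rintegral; congr fine.
have mAS : measurable (A q `&` unit_square) by exact: measurableI.
transitivity (\int[P]_(w in V @^-1` (A q `&` unit_square)) (Y w)%:E)%E.
  rewrite [RHS]integral_mkcond; apply: eq_integral => w _.
  rewrite patchE indicE; case: ifPn => [/set_mem [Aw _]|].
    by rewrite mem_set// mul1r.
  rewrite notin_setE => nA; rewrite memNset ?mul0r// => Aw.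
  by apply: nA; split.
rewrite YmE//.
rewrite (@integral_density _ _ Omega _ R P (lebesgue2 R) V h unit_square mV mS VS mh
  Vh _ _ mm mVi mAS); last exact: subIsetr.
by apply: eq_integral => v /set_mem [_ vS]; rewrite /g/= clamp2_id.
Qed.

Lemma mtr_formula p : in_cond_support_interior P E G p -> h p != 0 ->
  mixed12_exists psi p /\ m p = - (h p)^-1 * mixed12 psi p.
Proof.
move=> Ep hp.
have pS : \forall q \near p, unit_square q.
  by apply: filterS Ep => q; exact: cond_support_closed.
have [p1 p2] := near_unit_square_gt0 _ _ pS.
have [] := mixed12_rect_int _ g psi C c p cg p1 p2 dC.
  by apply: filterS Ep => q; exact: regression_rect.
move=> ex ->; split=> //.
rewrite /g/= clamp2_id; last exact: (nbhs_singleton pS).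
by rewrite mulrNN mulrC mulfK.
Qed.

End mtr_formula.

Lemma le_indic_cross (R : realType) (A : set (R * R)) (q v : R * R) (e y : R) (b : bool) :
  (e < `|v.1 - q.1| -> e < `|v.2 - q.2| -> b = `[< A v >]) ->
  `|b%:R * y - \1_A v * y| <= \1_(cross R q e) v * `|y|.
Proof.
move=> bA; rewrite -mulrBl normrM [in leRHS]indicE.
have [_|/negP ncross] := boolP (v \in cross R q e).
  apply: ler_wpM2r => //; rewrite indicE.
  by case: b {bA} => //; case: (v \in A);
    rewrite ?subrr ?subr0 ?sub0r ?normrN ?normr0 ?normr1.
rewrite bA; first by rewrite indicE -[v \in A]/(`[< A v >]) subrr normr0 mul0r.
- by rewrite ltNge; apply/negP => vq; apply: ncross; rewrite inE; left.
- by rewrite ltNge; apply/negP => vq; apply: ncross; rewrite inE; right.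
Qed.

(** * Treatment cells of the game *)

Section cdf.
Context d (Omega : measurableType d) (R : realType) (P : probability Omega R).
Variables (eps : Omega -> R) (F : R -> R).
Hypothesis meps : measurable_fun setT eps.
Hypothesis FE : forall t, P [set w | eps w <= t] = (F t)%:E.

Let measurable_le t : measurable [set w | eps w <= t].
Proof.
rewrite -[X in measurable X]setTI (_ : [set w | _] = eps @^-1` `]-oo, t]).
  exact: meps.
by apply/seteqP; split=> w; rewrite /= in_itv.
Qed.

Lemma cdf_itv t : 0 <= F t <= 1.
Proof. by rewrite -!lee_fin -FE measure_ge0 probability_le1. Qed.

Lemma cdf_nondecreasing s t : s <= t -> F s <= F t.
Proof.
move=> st; rewrite -lee_fin -!FE; apply: le_measure; rewrite ?inE//.
by move=> w /= /le_trans; apply.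
Qed.

Lemma cdf_lt s t : F s < F t -> s < t.
Proof. by rewrite !ltNge; apply: contra; exact: cdf_nondecreasing. Qed.

End cdf.
Arguments cdf_itv {d Omega R P eps F}.
Arguments cdf_lt {d Omega R P eps F}.

Lemma near_side (R : realType) (q G v e : R) :
  `|q - G| < e -> e < `|v - q| -> (v < G /\ v <= q) \/ (G < v /\ q < v).
Proof.
rewrite ltr_distl => qG; have [vq|vq] := leP v q.
  by rewrite ler0_norm; [left; split|]; lra.
by rewrite gtr0_norm; [right; split|]; lra.
Qed.

Arguments near_side {R q G v e}.

(* Everything is conditional on X = x (x fixed): Omega/P is the probability
   space of the conditional law given X = x; see NOTES.md. *)
Theorem theorem1
  (R : realType) (d : measure_display) (Omega : measurableType d)
  (P : probability Omega R)
  (dT1 dT2 : measure_display) (T1 : measurableType dT1) (T2 : measurableType dT2)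
  (Z1 : Omega -> T1) (Z2 : Omega -> T2)          (* instruments Z_j *)
  (eps1 eps2 : Omega -> R)                       (* eps_j *)
  (F1 F2 : R -> R)                               (* F_{eps_j}( . | X = x) *)
  (pi1 : bool -> T1 -> R) (pi2 : bool -> T2 -> R) (* pi_j^{d}(x, .) *)
  (D1 D2 : Omega -> bool)                        (* treatments *)
  (U1 : bool -> bool -> Omega -> R)              (* U_1^{(d1,d2)} *)
  (mu1 : bool -> bool -> R -> R)                 (* mu_1^{(d1,d2)}(x, .) *)
  (h : R * R -> R)                               (* h( . | x) *)
  (m10 m01 : R * R -> R)                         (* m^{(1,0)}(x,.), m^{(0,1)}(x,.) *)
  (psi10 psi01 : R * R -> R) :                   (* psi^{(1,0)}(x,.), psi^{(0,1)}(x,.) *)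
  let V1 := fun w => F1 (eps1 w) in
  let V2 := fun w => F2 (eps2 w) in
  let P10 := fun w => F1 (pi1 false (Z1 w)) in
  let P11 := fun w => F1 (pi1 true (Z1 w)) in
  let P20 := fun w => F2 (pi2 false (Z2 w)) in
  let P21 := fun w => F2 (pi2 true (Z2 w)) in
  let Y1d := fun (d1 d2 : bool) w => mu1 d1 d2 (U1 d1 d2 w) in
  let I := fun (d1 d2 : bool) w => ((D1 w == d1) && (D2 w == d2))%:R : R in
  let Y1 := fun w => \sum_(d1 : bool) \sum_(d2 : bool) I d1 d2 w * Y1d d1 d2 w in
  (* measurability of the primitives *)
  measurable_fun setT Z1 -> measurable_fun setT Z2 ->
  measurable_fun setT eps1 -> measurable_fun setT eps2 ->
  (forall b, measurable_fun setT (pi1 b)) -> (forall b, measurable_fun setT (pi2 b)) ->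
  (forall d1 d2, measurable_fun setT (U1 d1 d2)) ->
  (forall d1 d2, measurable_fun setT (mu1 d1 d2)) ->
  measurable [set w | D1 w] -> measurable [set w | D2 w] ->
  (* F_j is the (continuous) CDF of eps_j *)
  (forall t, P [set w | eps1 w <= t] = (F1 t)%:E) ->
  (forall t, P [set w | eps2 w <= t] = (F2 t)%:E) ->
  continuous F1 -> continuous F2 ->
  (* treatment decisions: D_j = 1{pi_j(D_{-j}, W_j) >= eps_j} *)
  (forall w, D1 w = (eps1 w <= pi1 (D2 w) (Z1 w))) ->
  (forall w, D2 w = (eps2 w <= pi2 (D1 w) (Z2 w))) ->
  (* (a) strategic complementarity *)
  {ae P, forall w, P10 w < P11 w} ->
  {ae P, forall w, P20 w < P21 w} ->
  (* (b) h is the joint density of V = (V1, V2) given X = x *)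
  (forall A : set (R * R), measurable A ->
     P ((fun w => (V1 w, V2 w)) @^-1` A) =
     (\int[(@lebesgue_measure R) \x (@lebesgue_measure R)]_(v in A) (h v)%:E)%E) ->
  (* (c) exclusion (mu_1 does not depend on Z) and independence *)
  (forall d1 d2, indep_rv P (fun w => (Z1 w, Z2 w))
                            (fun w => (eps1 w, eps2 w, U1 d1 d2 w))) ->
  (* (d) pi_j^0(W_j), pi_j^1(W_j) continuously distributed given X = x *)
  (forall b t, P [set w | pi1 b (Z1 w) = t] = 0%E) ->
  (forall b t, P [set w | pi2 b (Z2 w) = t] = 0%E) ->
  (* the MTR functions m^{(1,0)}, m^{(0,1)} *)
  cond_exp_version P (Y1d true false) (fun w => (V1 w, V2 w)) m10 ->
  cond_exp_version P (Y1d false true) (fun w => (V1 w, V2 w)) m01 ->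
  (* the regression functions psi^{(1,0)}, psi^{(0,1)} (continuous versions) *)
  cond_exp_version P (fun w => I true false w * Y1 w) (fun w => (P10 w, P21 w)) psi10 ->
  cond_exp_version P (fun w => I false true w * Y1 w) (fun w => (P11 w, P20 w)) psi01 ->
  continuous psi10 -> continuous psi01 ->
  (* continuity of m^{(1,0)}, m^{(0,1)} and h in (v1, v2) *)
  {within unit_square, continuous m10} ->
  {within unit_square, continuous m01} ->
  {within unit_square, continuous h} ->
  (forall p : R * R,
     in_cond_support_interior P [set w | I true false w = 1]
       (fun w => (P10 w, P21 w)) p ->
     h p != 0 ->
     mixed12_exists psi10 p /\ m10 p = - (h p)^-1 * mixed12 psi10 p) /\
  (forall p : R * R,
     in_cond_support_interior P [set w | I false true w = 1]
       (fun w => (P11 w, P20 w)) p ->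
     h p != 0 ->
     mixed12_exists psi01 p /\ m01 p = - (h p)^-1 * mixed12 psi01 p).
Proof.
move=> V1 V2 P10 P11 P20 P21 Y1d I Y1 mZ1 mZ2 me1 me2 mpi1 mpi2 mU mmu mD1 mD2.
move=> F1E F2E cF1 cF2 D1E D2E compl1 compl2 Vh indep _ _ m10E m01E psi10E psi01E.
move=> cpsi10 cpsi01 cm10 cm01 ch.
pose V w := (V1 w, V2 w).
have mF1 := continuous_measurable_fun cF1; have mF2 := continuous_measurable_fun cF2.
have mV : measurable_fun setT V.
  by apply: measurable_fun_pair; exact: measurableT_comp.
have mP1 b : measurable_fun setT (fun w => F1 (pi1 b (Z1 w))).
  by apply: (measurableT_comp mF1); exact: measurableT_comp.
have mP2 b : measurable_fun setT (fun w => F2 (pi2 b (Z2 w))).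
  by apply: (measurableT_comp mF2); exact: measurableT_comp.
have mY d1 d2 : measurable_fun setT (Y1d d1 d2) by exact: measurableT_comp.
have VS w : unit_square (V w) by split; [exact: (cdf_itv me1 F1E)|exact: (cdf_itv me2 F2E)].
have GS b1 b2 w : unit_square (F1 (pi1 b1 (Z1 w)), F2 (pi2 b2 (Z2 w))).
  by split; [exact: (cdf_itv me1 F1E)|exact: (cdf_itv me2 F2E)].
have GVY b1 b2 d1 d2 :
    indep_rv P (fun w => (F1 (pi1 b1 (Z1 w)), F2 (pi2 b2 (Z2 w))))
      (fun w => (V w, Y1d d1 d2 w)).
  apply: (indep_rv_comp (indep d1 d2) _ _ _ _
    (fun z => (F1 (pi1 b1 z.1), F2 (pi2 b2 z.2)))
    (fun u => ((F1 u.1.1, F2 u.1.2), mu1 d1 d2 u.2))).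
  - by apply: measurable_fun_pair; [apply: (measurableT_comp mF1)|apply: (measurableT_comp mF2)];
      exact: measurableT_comp.
  - apply: measurable_fun_pair; last exact: measurableT_comp.
    apply: measurable_fun_pair.
      apply: (measurableT_comp mF1).
      exact: (measurableT_comp measurable_fst measurable_fst).
    apply: (measurableT_comp mF2).
    exact: (measurableT_comp measurable_snd measurable_fst).
have mE d1 d2 : measurable [set w | I d1 d2 w = 1].
  have mD (D : Omega -> bool) b : measurable [set w | D w] -> measurable [set w | D w == b].
    case: b => mD; first by under eq_set do rewrite eqb_id.
    rewrite (_ : [set w | _] = ~` [set w | D w]); first exact: measurableC.
    by apply/seteqP; split=> w /=; case: (D w).
  rewrite (_ : [set w | _] = [set w | D1 w == d1] `&` [set w | D2 w == d2]).
    by apply: measurableI; exact: mD.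
  apply/seteqP; split=> w; rewrite /I/=.
    by case: (D1 w == d1); case: (D2 w == d2) => //= /esym/eqP; rewrite oner_eq0.
  by case=> -> ->.
have JE d1 d2 w : I d1 d2 w * Y1 w = I d1 d2 w * Y1d d1 d2 w.
  rewrite /Y1 !big_bool /I.
  by case: d1; case: d2; case: (D1 w); case: (D2 w) => /=;
    rewrite ?(mul0r, mul1r, addr0, add0r).
have ball1 (q G : R * R) e : ball q e G -> `|q.1 - G.1| < e /\ `|q.2 - G.2| < e by [].
split=> p.
- pose A (q : R * R) : set (R * R) := `]-oo, q.1] `*` `]q.2, +oo[.
  pose g := (fun v => m10 v * h v) \o @clamp2 R.
  have cg : continuous g := continuousM_clamp2 _ _ _ cm10 ch.
  apply: (@mtr_formula _ _ R P (fun w => (P10 w, P21 w)) V (Y1d true false)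
    (fun w => I true false w * Y1 w) h m10 psi10 A
    (fun a _ => rect_int g a 1) (cst 0)) => //.
  + exact: (measurable_fun_pair (mP1 false) (mP2 true)).
  + by move=> q; exact: measurableX.
  + exact: GS.
  + exact: GVY.
  + move=> q e e0; apply: filterS compl1 => w c1 /ball1[/= q1 q2].
    rewrite JE; apply: le_indic_cross => /= v1 v2.
    have a01 := cdf_lt me1 F1E _ _ c1.
    have -> : `[< A q (V w) >] = (V1 w <= q.1) && (q.2 < V2 w).
      by apply/asboolP/andP; rewrite /A/= !in_itv/= andbT.
    have [[/(cdf_lt me1 F1E) e1 ->]|[/(cdf_lt me1 F1E) e1 qV1]] := near_side q1 v1;
      last first.
      rewrite [V1 w <= _]leNgt qV1; apply/negbTE/negP => /andP[/eqP D1t /eqP D2f].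
      by move: (D1E w); rewrite D1t D2f leNgt e1.
    have [[/(cdf_lt me2 F2E) e2 qV2]|[/(cdf_lt me2 F2E) e2 ->]] := near_side q2 v2.
      rewrite ltNge qV2; apply/negbTE/negP => /andP[/eqP D1t /eqP D2f].
      by move: (D2E w); rewrite D1t D2f ltW.
    have D1t : D1 w by rewrite D1E ltW//; case: (D2 w) => //; exact: lt_trans a01.
    by rewrite D2E D1t leNgt e2.
  + move=> q [/andP[q10 q11] /andP[q20 q21]]; apply: Rintegral_rectangleD => //.
    * by apply: measurableI; [exact: measurableX|exact: measurable_unit_square].
    * apply/seteqP; split => -[x y]; rewrite /A /unit_square/= !in_itv/=.
        move=> [/andP[x0 xq] /andP[y0 y1]].
        by have [yq|yq] := ltP q.2 y; [left; split; split|right; split]; lra.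
      by case=> [[[xq yq] [x01 y01]]|[x0q y0q]]; split; lra.
    * apply/disj_setPS => -[x y]; rewrite /A /unit_square/= !in_itv/=.
      by move=> [[[_ yq] _] [_ y0q]]; lra.
- pose A (q : R * R) : set (R * R) := `]q.1, +oo[ `*` `]-oo, q.2].
  pose g := (fun v => m01 v * h v) \o @clamp2 R.
  have cg : continuous g := continuousM_clamp2 _ _ _ cm01 ch.
  apply: (@mtr_formula _ _ R P (fun w => (P11 w, P20 w)) V (Y1d false true)
    (fun w => I false true w * Y1 w) h m01 psi01 A
    (fun _ b => rect_int g 1 b) (row_int g 1)) => //.
  + exact: (measurable_fun_pair (mP1 true) (mP2 false)).
  + by move=> q; exact: measurableX.
  + exact: GS.
  + exact: GVY.
  + move=> q e e0; apply: filterS compl1 => w c1 /ball1[/= q1 q2].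
    rewrite JE; apply: le_indic_cross => /= v1 v2.
    have a01 := cdf_lt me1 F1E _ _ c1.
    have -> : `[< A q (V w) >] = (q.1 < V1 w) && (V2 w <= q.2).
      by apply/asboolP/andP; rewrite /A/= !in_itv/= andbT.
    have [[/(cdf_lt me1 F1E) e1 qV1]|[/(cdf_lt me1 F1E) e1 ->]] := near_side q1 v1.
      rewrite ltNge qV1; apply/negbTE/negP => /andP[/eqP D1f /eqP D2t].
      by move: (D1E w); rewrite D1f D2t ltW.
    have [[/(cdf_lt me2 F2E) e2 ->]|[/(cdf_lt me2 F2E) e2 qV2]] := near_side q2 v2;
      last first.
      rewrite [V2 w <= _]leNgt qV2; apply/negbTE/negP => /andP[/eqP D1f /eqP D2t].
      by move: (D2E w); rewrite D1f D2t leNgt e2.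
    have D1f : D1 w = false.
      rewrite D1E; apply/negbTE; rewrite -ltNge; case: (D2 w) => //.
      exact: lt_trans a01 e1.
    by rewrite D2E D1f ltW.
  + move=> q [/andP[q10 q11] /andP[q20 q21]]; apply: Rintegral_rectangleD => //.
    * by apply: measurableI; [exact: measurableX|exact: measurable_unit_square].
    * apply/seteqP; split => -[x y]; rewrite /A /unit_square/= !in_itv/=.
        move=> [/andP[x0 xq] /andP[y0 y1]].
        by have [xq'|xq'] := ltP q.1 x; [left; split; split|right; split]; lra.
      by case=> [[[xq yq] [x01 y01]]|[x0q y0q]]; split; lra.
    * apply/disj_setPS => -[x y]; rewrite /A /unit_square/= !in_itv/=.
      by move=> [[[xq _] _] [x0q _]]; lra.
  + by move=> a b b0; exact: derive_rect_int.
Qed.
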